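(* Let $N\ge 1$ be an integer and let $(\mathcal{F}_n : 1 \leq n \leq N)$ be a filtration in a discrete probability space $(\Omega, \mathcal{F}, \mathbb{P})$. Then there is a sequence of probability spaces $\big((S_i, \mathcal{S}_i, \mu_i) : i \in \mathbb{N}_0\big)$ such that for any martingale $(f_n : 1 \leq n \leq N)$ on $(\Omega, \mathcal{F}, \mathbb{P})$ with respect to $(\mathcal{F}_n : 1 \leq n \leq N)$ there is a sequence $(\tilde{f}_n : 1 \leq n \leq N)$ of random variables on the product space $$(S, \mathcal{S}, \mu) = \bigotimes_{i = 0}^\infty (S_i, \mathcal{S}_i, \mu_i)$$ which is a martingale with respect to the canonical filtration of $(S,\mathcal{S},\mu)$ and has the same joint distribution as $(f_n : 1 \leq n \leq N)$.
   Context: $\mathbb{N}_0=\{0,1,2,\dots\}$. A probability space $(\Omega,\mathcal{F},\mathbb{P})$ is discrete if $\Omega$ is at most countable. A filtration is an increasing sequence of sub-$\sigma$-fields of $\mathcal{F}$: $\mathcal{F}_n\subset\mathcal{F}_{n+1}$. A sequence of (real-valued) integrable random variables $(f_n)$ is a martingale with respect to $(\mathcal{F}_n)$ if $\mathbb{E}(f_m\mid \mathcal{F}_n)=f_n$ for all $m\ge n$. On a product space $(S,\mathcal{S},\mu)=\bigotimes_{i=0}^\infty (S_i,\mathcal{S}_i,\mu_i)$ the canonical filtration is the sequence of $\sigma$-fields whose $n$-th member is generated by the projection $s\mapsto (s_0,s_1,\dots,s_n)$. Note that the spaces $(S_i,\mathcal{S}_i,\mu_i)$ depend only on the filtration $(\mathcal{F}_n)$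 and not on the martingale $(f_n)$. *)

(* Defs.v *)
From HB Require Import structures.
From mathcomp Require Import all_boot all_order all_algebra.
From mathcomp Require Import all_classical all_reals all_analysis.
Import Order.TTheory GRing.Theory Num.Theory.
Import numFieldNormedType.Exports.

Set Implicit Arguments.
Unset Strict Implicit.
Unset Printing Implicit Defensive.

Local Open Scope classical_set_scope.
Local Open Scope ring_scope.

Definition discrete_space d (T : measurableType d) : Prop :=
  countable [set: T].

Definition filtration d (T : measurableType d) (N : nat)
    (F : nat -> set (set T)) :=
  (forall n, (1 <= n <= N)%N ->
     sigma_algebra [set: T] (F n) /\ F n `<=` measurable) /\
  (forall n, (1 <= n < N)%N -> F n `<=` F n.+1).

(* Y is a version of the conditional expectation of X given G. *)
Definition cond_expectation d (T : measurableType d) (R : realType)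
    (P : probability T R) (G : set (set T)) (X Y : T -> R) :=
  [/\ g_sigma_algebra_preimage Y `<=` G,
      P.-integrable [set: T] (EFin \o Y) &
      forall A, G A ->
        (\int[P]_(x in A) (Y x)%:E = \int[P]_(x in A) (X x)%:E)%E].

(* Only the values f n and F n with 1 <= n <= N are relevant. The case m = n of
   the second clause says that f is adapted to F. *)
Definition martingale d (T : measurableType d) (R : realType)
    (P : probability T R) (N : nat) (F : nat -> set (set T))
    (f : nat -> T -> R) :=
  (forall n, (1 <= n <= N)%N -> P.-integrable [set: T] (EFin \o f n)) /\
  (forall n m, (1 <= n)%N -> (n <= m <= N)%N ->
     cond_expectation P (F n) (f m) (f n)).

Definition joint_distribution d (T : measurableType d) (R : realType)
    (P : probability T R) (N : nat) (f : nat -> T -> R) :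
    set (N.-tuple R) -> \bar R :=
  pushforward P (fun x => [tuple f i.+1 x | i < N]).
Arguments joint_distribution {d T R} P N f.

Definition same_joint_distribution d (T : measurableType d)
    d' (T' : measurableType d') (R : realType)
    (P : probability T R) (P' : probability T' R) (N : nat)
    (f : nat -> T -> R) (f' : nat -> T' -> R) :=
  forall B : set (N.-tuple R), measurable B ->
    joint_distribution P N f B = joint_distribution P' N f' B.

Definition coordinate_sets (I : Type) (d : I -> measure_display)
    (S : forall i, measurableType (d i)) : set (set (forall i, S i)) :=
  \bigcup_i preimage_set_system [set: forall i, S i] (fun s => s i) measurable.
Arguments coordinate_sets {I d} S.

Definition product_space (I : Type) (d : I -> measure_display)
    (S : forall i, measurableType (d i)) :
    measurableType (sigma_display (coordinate_sets S)) :=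
  g_sigma_algebraType (coordinate_sets S).

(* Such a Q is unique: see product_measure_unique. *)
Definition is_product_measure (R : realType) (d : nat -> measure_display)
    (S : forall i, measurableType (d i)) (mu : forall i, probability (S i) R)
    (Q : probability (product_space S) R) :=
  forall (n : nat) (A : forall i, set (S i)), (forall i, measurable (A i)) ->
    Q [set s | forall i, (i < n)%N -> A i (s i)]
    = (\prod_(i < n) mu i (A i))%E.

Definition initial_projection (d : nat -> measure_display)
    (S : forall i, measurableType (d i)) (n : nat) (s : product_space S) :
    product_space (fun i : 'I_n.+1 => S i) :=
  fun i => s i.

Definition canonical_filtration (d : nat -> measure_display)
    (S : forall i, measurableType (d i)) (n : nat) :
    set (set (product_space S)) :=
  g_sigma_algebra_preimage (@initial_projection d S n).
Arguments canonical_filtration {d} S n.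

Lemma measurable_coordinate (I : Type) (d : I -> measure_display)
    (S : forall i, measurableType (d i)) (i : I) :
  measurable_fun [set: product_space S] (fun s => s i).
Proof.
move=> _ B mB; apply: sub_sigma_algebra; exists i => //.
by exists B.
Qed.

Lemma product_measure_unique (R : realType) (d : nat -> measure_display)
    (S : forall i, measurableType (d i)) (mu : forall i, probability (S i) R)
    (Q Q' : probability (product_space S) R) :
  is_product_measure mu Q -> is_product_measure mu Q' ->
  forall B, measurable B -> Q B = Q' B.
Proof.
move=> Qmu Q'mu B mB.
pose rect n (A : forall i, set (S i)) : set (product_space S) :=
  [set s | forall i, (i < n)%N -> A i (s i)].
pose G := [set B | exists n A, (forall i, measurable (A i)) /\ B = rect n A].
have mrect n A : (forall i, measurable (A i)) -> measurable (rect n A).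
  move=> mA.
  have -> : rect n A = \bigcap_(i in [set i | (i < n)%N]) ((fun s => s i) @^-1` A i).
    by apply/seteqP; split=> s /= As i /As.
  apply: bigcap_measurableType => // i _.
  by rewrite -[X in measurable X]setTI; exact: measurable_coordinate.
apply: (g_sigma_algebra_measure_unique G _ (fun=> setT)).
- by move=> _ [n [A [mA ->]]]; exact: mrect.
- move=> _; exists 0%N, (fun=> setT); split; first by move=> i; exact: measurableT.
  by apply/seteqP; split.
- by apply/seteqP; split => // x _; exists 0%N.
- move=> _ _ [n [A [mA ->]]] [n' [A' [mA' ->]]].
  exists (maxn n n'), (fun i =>
    (if (i < n)%N then A i else setT) `&` (if (i < n')%N then A' i else setT)).
  split.
    by move=> i; apply: measurableI; case: ifP => // _; exact: measurableT.
  apply/seteqP; split=> s /=.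
    by move=> [As A's] i _; split; case: ifP => // /[dup] ? ?; [exact: As|exact: A's].
  move=> H; split=> i ii; have := H i; rewrite leq_max ii ?orbT => /(_ isT)[].
    by [].
  by [].
- by move=> _ [n [A [mA ->]]]; exact: etrans (Qmu n A mA) (esym (Q'mu n A mA)).
- move=> _; apply: (@le_lt_trans _ _ 1%E); last exact: ltry.
  by apply: probability_le1; exact: measurableT.
move: B mB; apply: sub_sigma_algebra2.
move=> _ [i _ [C mC <-]]; rewrite setTI.
exists i.+1, (dfwith (fun=> setT) i C); split.
  move=> j; case: (eqVneq j i) => [->|ji]; first by rewrite dfwithin.
  by rewrite dfwithout 1?eq_sym//; exact: measurableT.
apply/seteqP; split=> s /=.
  move=> Cs j _; case: (eqVneq j i) => [->|ji]; first by rewrite dfwithin.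
  by rewrite dfwithout 1?eq_sym.
by move=> /(_ i (ltnSn i)); rewrite dfwithin.
Qed.

Lemma canonical_filtration_filtration (d : nat -> measure_display)
    (S : forall i, measurableType (d i)) (N : nat) :
  filtration N (canonical_filtration S).
Proof.
have mproj d' (T : measurableType d') n (h : T -> product_space (fun i : 'I_n.+1 => S i)) :
    (forall i : 'I_n.+1, measurable_fun [set: T] (fun t => h t i)) ->
    measurable_fun [set: T] h.
  move=> mh; apply: measurability; first by [].
  move=> _ [_ [i _ [C mC <-]] <-].
  rewrite !setTI -[X in measurable X]setTI.
  exact: mh.
split=> n _.
- split; first exact/sigma_algebra_preimage/sigma_algebra_measurable.
  move=> _ [B mB <-]; apply: mproj => // i; exact: measurable_coordinate.
- move=> _ [B mB <-].
  pose h (s : product_space (fun i : 'I_n.+2 => S i)) :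
      product_space (fun i : 'I_n.+1 => S i) := fun i => s (widen_ord (leqnSn _) i).
  exists (h @^-1` B) => //.
  rewrite -[X in measurable X]setTI; apply: mproj => // i.
  exact: (@measurable_coordinate 'I_n.+2 (fun i => d i) (fun i => S i)
    (widen_ord (leqnSn _) i)).
Qed.

(* Main.v *)
From HB Require Import structures.
Require Import Defs.
From mathcomp Require Import all_boot all_order all_algebra.
From mathcomp Require Import all_classical all_reals all_analysis.
Import Order.TTheory GRing.Theory Num.Theory.
Import numFieldNormedType.Exports.

(** On a countable space each [F n] is generated by its atoms, so a point may be
    sampled level by level.  Start anywhere; given a point [w] lying in an atom
    [A] of [F n], use a fresh uniform variable on [[0, 1]] to draw a point of
    [A] whose [F n.+1]-atom has law [P (. | A)].  The point [W] reached after [N]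
    steps has law [P] on [F N], and whether it lies in a given set of [F n] is
    already decided by the first [n] draws.  The sequence [f n \o W] thus has the
    joint law of [f], and it is a martingale because each new draw is independent
    of the earlier ones. *)

Set Implicit Arguments.
Unset Strict Implicit.
Unset Printing Implicit Defensive.

Local Open Scope classical_set_scope.
Local Open Scope ring_scope.

(** * Atoms of a sigma-algebra on a countable space *)

Lemma sigma_algebra_countable_bigcup (T : Type) (I : Type) (G : set (set T))
    (E : I -> set T) :
  countable [set: I] -> sigma_algebra setT G -> (forall i, G (E i)) ->
  G (\bigcup_i E i).
Proof.
move=> /countable_injP[e einj] [G0 GC GU] GE.
(* [E' n] is [E i] when [n] is the code of [i] and empty when [n] codes nothing, which turns the
   union into one over [nat]. *)
pose E' n := \bigcup_(i in [set i | e i = n]) E i.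
have -> : \bigcup_i E i = \bigcup_n E' n.
  apply/seteqP; split=> [x [i _ Eix]|x [n _ [i _ Eix]]]; last by exists i.
  by exists (e i) => //; exists i.
apply: GU => n; have [[i ein]|noi] := pselect (exists i, e i = n).
  rewrite /E' (_ : [set i | e i = n] = [set i]) ?bigcup_set1//.
  apply/seteqP; split=> [j/= ejn|j/= ->//].
  by apply: einj; rewrite ?inE// ein ejn.
rewrite /E' (_ : [set i | e i = n] = set0) ?bigcup_set0// -subset0 => i ei.
by apply: noi; exists i.
Qed.

(* [X] numbers the atoms of [G]: on a countable space, a point is separated
   from the others by countably many members of [G]. *)
Lemma countable_sigma_algebra_atoms (T : Type) (G : set (set T)) :
  countable [set: T] -> sigma_algebra setT G ->
  exists X : T -> nat, (forall B : set nat, G (X @^-1` B)) /\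
    (forall D x y, G D -> X x = X y -> D x -> D y).
Proof.
move=> cT sG; have [G0 GC GU] := sG.
have /countable_injP[e einj] := cT.
pose atom x := [set y | forall D, G D -> D x -> D y].
have atom_sym x y D : atom x y -> G D -> D y -> D x.
  move=> xy GD Dy; apply: contrapT => nDx.
  have /xy : G (setT `\` D) by exact: GC.
  by move=> /(_ (conj I nDx))[].
(* The complement of the atom is a countable union: each [y] outside it lies in some member of [G]
   that misses [x]. *)
have Gatom x : G (atom x).
  have /choice[E GE] : forall y, exists E,
      [/\ G E, ~ E x & ~ atom x y -> E y].
    move=> y; have [xy|] := pselect (atom x y).
      by exists set0; split => // /(_ xy).
    move=> /existsNP[D /not_implyP[GD /not_implyP[Dx nDy]]].
    by exists (setT `\` D); split => //; [exact: GC|case].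
  rewrite (_ : atom x = setT `\` \bigcup_y E y).
    by apply: GC; apply: sigma_algebra_countable_bigcup => // y; have [] := GE y.
  apply/seteqP; split=> [z xz|z [_ nEz]].
    split=> // -[y _ Eyz]; have [GEy nEyx _] := GE y.
    exact/nEyx/(atom_sym _ _ _ xz).
  by apply: contrapT => nxz; apply: nEz; exists z => //; have [_ _] := GE z; apply.
have atom_eq x y : atom x y -> atom x = atom y.
  move=> xy; apply/seteqP; split=> z zz D GD Dx.
    by apply: zz => //; exact: (atom_sym _ _ _ xy).
  by apply: zz => //; exact: xy.
(* The chosen code depends on the set [atom x] alone, so points of one atom get the same number. The
   default is never taken, since [x] lies in its own atom. *)
pose X x := xget 0%N (e @` atom x).
have Xatom x : exists2 z, atom x z & e z = X x.
  suff [z] : (e @` atom x) (X x) by exists z.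
  by apply: xgetPex; exists (e x); exists x.
exists X; split=> [B|D x y GD Xxy Dx].
  rewrite (_ : X @^-1` B = \bigcup_y (if `[< B (X y) >] then atom y else set0)).
    apply: sigma_algebra_countable_bigcup => // y; case: ifP => _ //; exact: Gatom.
  apply/seteqP; split=> [z Bz|z [y _]].
    by exists z => //; case: asboolP => // _ D.
  by case: asboolP => // By yz; rewrite /= /X -(atom_eq _ _ yz).
have [z xz ez] := Xatom x; have [w yw ew] := Xatom y.
apply: (atom_sym _ w) => //; rewrite -(einj z w) ?inE//; first exact: xz.
by rewrite ez ew.
Qed.

(** * Sampling discrete laws from a uniform variable *)

(** This isolates what is asked of the source of randomness, so that the space of draws can stay
    abstract. *)
Definition samples_nat (R : realType) d (U : measurableType d)
    (nu : probability U R) :=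
  forall p : nat -> R, (forall k, 0 <= p k) ->
    (\sum_(0 <= k <oo) (p k)%:E = 1)%E ->
  exists q : U -> nat, measurable_fun setT q /\
    forall B : set nat,
      nu (q @^-1` B) = (\sum_(0 <= k <oo | k \in B) (p k)%:E)%E.

(** Inversion of the distribution function: consecutive half-open intervals [I k] of length [p k]
    are laid out from 0, and [q u] is the index of the one containing [u]. *)
Lemma uniform_samples_nat (R : realType) :
  samples_nat (uniform_prob (@ltr01 R)).
Proof.
move=> p p0 p1; pose U : probability _ R := uniform_prob (@ltr01 R).
pose c k := \sum_(0 <= i < k) p i.
have cS k : c k.+1 = c k + p k by rewrite /c big_nat_recr.
have c_nd : {homo c : m n / (m <= n)%N >-> m <= n}.
  by apply: homo_leq => [x//|x y z|k]; [exact: le_trans|rewrite cS lerDl].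
have c0 k : 0 <= c k by rewrite sumr_ge0.
have c1 k : c k <= 1.
  rewrite -lee_fin -p1 /c -sumEFin; apply: nneseries_lim_ge => n _.
  by rewrite lee_fin.
pose I k := `[c k, c k.+1[%classic : set (measurableTypeR R).
have mI k : measurable (I k) by exact: measurable_itv.
have UI k : U (I k) = (p k)%:E.
  rewrite /U/= /uniform_prob integral_uniform_pdf setIidl; last first.
    move=> x; rewrite /I /= !in_itv/= => /andP[cx xc].
    by rewrite (le_trans _ cx)// (le_trans (ltW xc)).
  rewrite (eq_integral (cst 1%E)); last first.
    move=> x; rewrite inE /I/= in_itv/= => /andP[cx xc].
    by rewrite /uniform_pdf (le_trans _ cx)//= (le_trans (ltW xc))//= subr0 invr1.
  rewrite integral_cst; last exact: mI.
  rewrite mul1e /I/= lebesgue_measure_itv/= lte_fin cS ltrDl.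
  case: ltP => [_|pk0]; first by rewrite -EFinD addrAC subrr add0r.
  by congr EFin; apply/eqP; rewrite eq_le p0 pk0.
have I_inj u j k : I j u -> I k u -> j = k.
  rewrite /I/= !in_itv/= => /andP[ju uj] /andP[ku uk].
  apply/eqP; rewrite eqn_leq; apply/andP; split; rewrite leqNgt; apply/negP => /c_nd.
    by rewrite leNgt (le_lt_trans ju uk).
  by rewrite leNgt (le_lt_trans ku uj).
have tI (B : set nat) : trivIset B I.
  by move=> j k _ _ [u [Iju Iku]]; exact: I_inj Iju Iku.
pose q u := xget 0%N [set k | I k u].
have qI k u : I k u -> q u = k.
  by move=> Iku; apply: (I_inj u) => //; apply: (@xgetPex _ 0%N [set k | I k u]); exists k.
(* Off the intervals [q] takes the default 0, so [N] belongs to the preimage of every [B] containing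
   0. It is null because the lengths sum to 1. *)
pose N := ~` \bigcup_k I k.
have mN : measurable N by apply: measurableC; exact: bigcup_measurable.
have UN : U N = 0%E.
  rewrite probability_setC; last exact: bigcup_measurable.
  rewrite measure_bigcup//=.
  under eq_eseriesr do rewrite UI.
  by rewrite (eq_eseriesl (Q := xpredT)) ?p1 ?subee// => k; rewrite in_setT.
have q0 u : N u -> q u = 0%N.
  move=> Nu; apply: xgetPN => k Iku; apply: Nu; by exists k.
have preq B : q @^-1` B = \bigcup_(k in B) I k `|` (N `&` [set _ | B 0%N]).
  apply/seteqP; split=> [u /= Bq|u [[k Bk Iku]|[Nu B0]]]; last 2 first.
  - by rewrite /= (qI k).
  - by rewrite /= q0.
  have [[k _ Iku]|Nu] := pselect ((\bigcup_k I k) u).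
    by left; exists k => //; rewrite -(qI _ _ Iku).
  by right; split => //; rewrite /= -(q0 u).
have mNB (B : set nat) : measurable (N `&` [set _ | B 0%N]).
  apply: measurableI => //; have [B0|B0] := pselect (B 0%N).
    by rewrite (_ : mkset _ = setT)//; apply/seteqP; split.
  by rewrite (_ : mkset _ = set0)//; apply/seteqP; split.
exists q; split=> [_ B mB|B].
  rewrite setTI preq; apply: measurableU => //; exact: bigcup_measurable.
change (U (q @^-1` B) = \sum_(0 <= k <oo | k \in B) (p k)%:E)%E.
rewrite preq measureU0//=; last 2 first.
- exact: bigcup_measurable.
- by apply/eqP; rewrite -measure_le0 -[leRHS]UN le_measure ?inE//; exact: subIsetl.
rewrite measure_bigcup//; by apply: eq_eseriesr => k _; exact: UI.
Qed.

(** A value [k] of [X] is drawn with its conditional probability given [A], then replaced by a fixed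
    point of [A] in the fiber of [k]. That point is arbitrary within its fiber, hence the
    restriction to saturated [D]. The law is cross-multiplied to cover null [A]. *)
Lemma conditional_sampling (R : realType) d (T : measurableType d)
    (P : probability T R) dU (U : measurableType dU) (nu : probability U R)
    (X : T -> nat) (A : set T) :
  samples_nat nu -> (forall B : set nat, measurable (X @^-1` B)) ->
  measurable A ->
  exists t : U -> T, (A !=set0 -> forall u, A (t u)) /\
    forall D, (forall x y, X x = X y -> D x -> D y) ->
      measurable (t @^-1` D) /\ (P A * nu (t @^-1` D) = P (A `&` D))%E.
Proof.
move=> samp mX mA.
have sat D : (forall x y, X x = X y -> D x -> D y) ->
    D = X @^-1` [set k | exists2 x, D x & X x = k].
  by move=> DX; apply/seteqP; split=> [x Dx|x [y Dy /DX]]; [exists x|exact].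
have mAX k : measurable (A `&` X @^-1` [set k]) by exact: measurableI.
have mcst (a : T) D : measurable ((fun _ : U => a) @^-1` D).
  have [Da|nDa] := pselect (D a).
    by rewrite (_ : _ @^-1` D = setT)//; apply/seteqP; split.
  by rewrite (_ : _ @^-1` D = set0)//; apply/seteqP; split.
have PA_fin : P A \is a fin_num by exact: fin_num_measure.
(* For null [A] both sides of the law vanish, and a constant map suffices, with value in [A] if
   possible. *)
have [PA0|PA_neq0] := eqVneq (P A) 0%E.
  have [a Aa] : exists a, A !=set0 -> A a.
    have [[a Aa]|A0] := pselect (A !=set0); first by exists a.
    by exists point.
  exists (fun=> a); split=> [/Aa//|D DX]; split; first exact: mcst.
  rewrite PA0 mul0e.
  apply/esym/eqP; rewrite -measure_le0 -[leRHS]PA0.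
  apply: le_measure; rewrite ?inE//.
  by apply: measurableI => //; rewrite (sat D).
have PA_gt0 : (0 < fine (P A))%R.
  by rewrite fine_gt0// lt0e PA_neq0 measure_ge0 ltey_eq PA_fin.
have [a Aa] : A !=set0.
  by apply/set0P; apply: contra_neq PA_neq0 => ->; rewrite measure0.
pose p k := fine (P (A `&` X @^-1` [set k])) / fine (P A).
have pE k : (P A * (p k)%:E = P (A `&` X @^-1` [set k]))%E.
  rewrite -[in LHS](fineK PA_fin) -EFinM /p mulrCA divff ?gt_eqF// mulr1.
  by rewrite fineK// fin_num_measure.
have p0 k : 0 <= p k by rewrite divr_ge0 ?fine_ge0.
have sum_pE (B : set nat) :
    (P A * (\sum_(0 <= k <oo | k \in B) (p k)%:E) = P (A `&` X @^-1` B))%E.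
  rewrite -(fineK PA_fin) -nneseriesZl => [|k _]; last by rewrite lee_fin.
  under eq_eseriesr do rewrite fineK// pE.
  rewrite -measure_bigcup//; last exact: trivIset_preimage1_in.
  congr (P _); rewrite -setI_bigcupr; congr (_ `&` _).
  by apply/seteqP; split=> [x [k Bk /= Xxk]|x Bx]; [rewrite /= Xxk|exists (X x)].
have [|q [mq qE]] := samp p p0.
  have := sum_pE setT; rewrite preimage_setT setIT.
  rewrite (eq_eseriesl (Q := xpredT)) => [|k]; last by rewrite in_setT.
  move/(congr1 (fun x => (fine (P A))^-1%:E * x)%E).
  have -> : P A = (fine (P A))%:E by rewrite fineK.
  by rewrite muleA -!EFinM mulVf ?gt_eqF// mul1e.
(* The default [a] lies in [A], so [r k] stays in [A] even when the fiber of [k] misses [A]. *)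
pose r k := xget a (A `&` X @^-1` [set k]).
have Ar k : A (r k).
  by rewrite /r; case: xgetP => [x _ []|_].
have Xr x : A x -> X (r (X x)) = X x.
  move=> Ax; suff [] : (A `&` X @^-1` [set X x]) (r (X x)) by [].
  by apply: xgetPex; exists x.
exists (r \o q); split=> [_ u|D DX]; first exact: Ar.
rewrite comp_preimage; split; first by rewrite -[X in measurable X]setTI; exact: mq.
rewrite qE sum_pE; congr (P _).
apply/seteqP; split=> x [Ax Dx]; split=> //; apply: DX Dx; first exact: Xr.
by rewrite Xr.
Qed.

(** * Product spaces and replacement of one coordinate *)

Section product_space.
Context (I : eqType) (dS : I -> measure_display).
Variable S : forall i, measurableType (dS i).

Lemma measurable_fun_product_space d (T : measurableType d)
    (h : T -> product_space S) :
  (forall i, measurable_fun [set: T] (fun t => h t i)) ->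
  measurable_fun [set: T] h.
Proof.
move=> mh; apply: measurability; first by [].
move=> _ [_ [i _ [C mC <-]] <-].
rewrite !setTI -[X in measurable X]setTI; exact: mh.
Qed.

Definition update (k : I) (st : product_space S * S k) : product_space S :=
  dfwith st.1 k st.2.

Lemma measurable_update k : measurable_fun [set: _] (@update k).
Proof.
apply: measurable_fun_product_space => i.
have [<-|ki] := eqVneq k i.
  rewrite (_ : (fun _ => _) = snd); first exact: measurable_snd.
  by apply/funext => st; rewrite /update dfwithin.
rewrite (_ : (fun _ => _) = (fun s : product_space S => s i) \o fst).
  by apply: measurableT_comp; [exact: measurable_coordinate|exact: measurable_fst].
by apply/funext => st; rewrite /update dfwithout.
Qed.

HB.instance Definition _ k :=
  isMeasurableFun.Build _ _ _ _ (@update k) (@measurable_update k).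
End product_space.

Lemma product_probabilityE (R : realType) d1 d2 (T1 : measurableType d1)
    (T2 : measurableType d2) (P1 : probability T1 R) (P2 : probability T2 R) A B :
  measurable A -> measurable B -> ((P1 \x P2) (A `*` B) = P1 A * P2 B)%E.
Proof. by move=> mA mB; exact: product_measure1E. Qed.

(** * Product measures on sequences and the canonical filtration *)

Section infinite_product.
Context (R : realType) (dS : nat -> measure_display).
Variable S : forall i, measurableType (dS i).
Implicit Types (mu : forall i, probability (S i) R)
  (Q : probability (product_space S) R).

Lemma measurable_box n (A : forall i, set (S i)) :
  (forall i, measurable (A i)) ->
  measurable ([set s | forall i, (i < n)%N -> A i (s i)] : set (product_space S)).
Proof.
move=> mA; rewrite (_ : mkset _ =
    \bigcap_(i in [set i | (i < n)%N]) ((fun s : product_space S => s i) @^-1` A i)).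
  apply: bigcap_measurableType => // i _.
  by rewrite -[X in measurable X]setTI; exact: measurable_coordinate.
by apply/seteqP; split=> s /= As i /As.
Qed.

(** The preimage of a box under [update] is a rectangle: the box with its side at [k] freed, times
    [A k]. The factor at [k] thus becomes 1 for [Q] and [nu (A k)] for the new draw. A box with
    [n <= k] does not see the change. *)
Lemma product_measure_resample mu Q k (nu : probability (S k) R) :
  is_product_measure mu Q ->
  is_product_measure (dfwith mu k nu)
    (distribution (Q \x nu)%E (@update _ _ S k)).
Proof.
move=> Qmu n A mA; rewrite /distribution /= /pushforward/=.
have [nk|kn] := leqP n k.
  rewrite (_ : _ @^-1` _ =
      [set s : product_space S | forall i, (i < n)%N -> A i (s i)] `*` setT).
    rewrite product_probabilityE//; last exact: measurable_box.
    rewrite probability_setT mule1 Qmu//; apply: eq_bigr => i _.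
    by rewrite dfwithout// gtn_eqF// (leq_trans (ltn_ord i)).
  apply/seteqP; split=> [[s t]/= As|[s t] [/= As _] i ni].
    split=> // i ni; have := As i ni.
    by rewrite /update dfwithout// gtn_eqF// (leq_trans ni).
  by rewrite /update dfwithout ?gtn_eqF ?(leq_trans ni)//; exact: As.
pose A' := dfwith A k setT.
have mA' i : measurable (A' i).
  rewrite /A'; have [<-|ki] := eqVneq k i; first by rewrite dfwithin.
  by rewrite dfwithout.
rewrite (_ : _ @^-1` _ =
    [set s : product_space S | forall i, (i < n)%N -> A' i (s i)] `*` A k); last first.
  apply/seteqP; split=> [[s t]/= As|[s t] [/= As At] i ni].
    split=> [i ni|]; last by have := As k kn; rewrite /update dfwithin.
    have := As i ni; rewrite /update /A'; have [<-|ki] := eqVneq k i.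
      by rewrite !dfwithin.
    by rewrite !dfwithout.
  rewrite /update/=; have [<-|ki] := eqVneq k i; first by rewrite dfwithin.
  by have := As i ni; rewrite /A' !dfwithout.
rewrite product_probabilityE//; last exact: measurable_box.
rewrite Qmu// (bigD1 (Ordinal kn))//= [RHS](bigD1 (Ordinal kn))//=.
rewrite /A' !dfwithin probability_setT mul1e muleC; congr (_ * _)%E.
apply: eq_bigr => i; rewrite -val_eqE/= eq_sym => ki.
by rewrite !dfwithout.
Qed.

(** Coordinates 0 to [n.-1] are resampled one after the other, so finitely many binary products
    suffice. *)
Lemma product_measure_splice mu mu0 Q n :
  is_product_measure mu0 Q ->
  exists Q', is_product_measure (fun i => if (i < n)%N then mu i else mu0 i) Q'.
Proof.
move=> Qmu0; elim: n => [|n [Q' Q'mu]]; first by exists Q.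
exists (distribution (Q' \x mu n)%E (@update _ _ S n)).
rewrite (_ : (fun i => _) = dfwith
    (fun i => if (i < n)%N then mu i else mu0 i) n (mu n)).
  exact: product_measure_resample.
apply/functional_extensionality_dep => i.
have [<-|ni] := eqVneq n i; first by rewrite dfwithin ltnSn.
by rewrite dfwithout// ltnS leq_eqVlt eq_sym (negbTE ni).
Qed.

(** Both sides are the indicator of the box at [s]. This provides a base measure for splicing. *)
Lemma dirac_product_measure (s : forall i, S i) :
  is_product_measure (fun i => dirac (s i) : probability (S i) R)
    (dirac (s : product_space S)).
Proof.
move=> n A mA; rewrite /= diracE.
have [As|/existsNP[i /not_implyP[ni nAi]]] :=
    pselect (forall i, (i < n)%N -> A i (s i)).
  rewrite mem_set//= big1// => i _; rewrite diracE mem_set//; exact: As.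
rewrite memNset/=; last by move=> /(_ i ni).
by rewrite (bigD1 (Ordinal ni))//= diracE memNset// mul0e.
Qed.

Section canonical_filtration_theory.
Variable n : nat.
Let CF := g_sigma_algebra_preimageType (@initial_projection _ S n).

Lemma canonical_filtration0 : canonical_filtration S n set0.
Proof. exact: (@measurable0 _ CF). Qed.

Lemma canonical_filtrationT : canonical_filtration S n setT.
Proof. exact: (@measurableT _ CF). Qed.

Lemma canonical_filtrationI A B : canonical_filtration S n A ->
  canonical_filtration S n B -> canonical_filtration S n (A `&` B).
Proof. exact: (@measurableI _ CF). Qed.

Lemma canonical_filtration_bigcup (A : nat -> set (product_space S)) :
  (forall k, canonical_filtration S n (A k)) ->
  canonical_filtration S n (\bigcup_k A k).
Proof. exact: (@bigcupT_measurable _ CF). Qed.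

Lemma canonical_filtrationS :
  canonical_filtration S n `<=` canonical_filtration S n.+1.
Proof.
move=> _ [B mB <-].
pose h (s : product_space (fun i : 'I_n.+2 => S i)) :
  product_space (fun i : 'I_n.+1 => S i) := fun i => s (widen_ord (leqnSn _) i).
exists (h @^-1` B) => //; rewrite -[X in measurable X]setTI.
apply: measurable_fun_product_space => // i.
exact: (@measurable_coordinate _ _ (fun i : 'I_n.+2 => S i)
  (widen_ord (leqnSn _) i)).
Qed.
End canonical_filtration_theory.

Lemma canonical_filtration_coordinate n i (E : set (S i)) :
  (i <= n)%N -> measurable E ->
  canonical_filtration S n ((fun s : product_space S => s i) @^-1` E).
Proof.
rewrite -ltnS => ni mE.
exists ((fun s : product_space (fun j : 'I_n.+1 => S j) => s (Ordinal ni)) @^-1` E).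
  rewrite -[X in measurable X]setTI.
  exact: (@measurable_coordinate _ _ (fun j : 'I_n.+1 => S j) (Ordinal ni)).
by rewrite setTI.
Qed.

Lemma canonical_filtration_measurable n : canonical_filtration S n `<=` measurable.
Proof.
move=> _ [B mB <-]; apply: measurable_fun_product_space => // i.
exact: measurable_coordinate.
Qed.

(* Resampling the coordinate [k] does not change the product measure, and makes
   it visibly independent of the coordinates below [k]. *)
Lemma canonical_filtration_independent mu Q n k (C : set (product_space S))
    (E : set (S k)) :
  is_product_measure mu Q -> canonical_filtration S n C -> (n < k)%N ->
  measurable E ->
  (Q (C `&` (fun s => s k) @^-1` E) = Q C * mu k E)%E.
Proof.
move=> Qmu CC nk mE.
have mC : measurable C by exact: canonical_filtration_measurable CC.
have [B mB CB] := CC.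
have mEk : measurable ((fun s : product_space S => s k) @^-1` E).
  by rewrite -[X in measurable X]setTI; exact: measurable_coordinate.
have Q'mu : is_product_measure mu (distribution (Q \x mu k)%E (@update _ _ S k)).
  rewrite [X in is_product_measure X](_ : _ = dfwith mu k (mu k)).
    exact: product_measure_resample.
  apply/functional_extensionality_dep => i.
  by have [<-|ki] := eqVneq k i; rewrite ?dfwithin// dfwithout.
rewrite (Defs.product_measure_unique Qmu Q'mu (measurableI _ _ mC mEk)).
rewrite /distribution /= /pushforward/= -product_probabilityE//; congr (_ _).
(* As [n < k], the first coordinates ignore the update, so the event pulls back to the rectangle of
   [C] and [E]. *)
have updP (s : product_space S) t :
    @initial_projection _ S n (@update _ _ S k (s, t)) = initial_projection s.
  apply/functional_extensionality_dep => i.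
  by rewrite /initial_projection /update dfwithout// gtn_eqF// (leq_trans (ltn_ord i)).
rewrite -CB !setTI; apply/seteqP; split=> [[s t]|[s t]] /=.
  by rewrite updP /update dfwithin.
by rewrite updP /update dfwithin.
Qed.
End infinite_product.

(** * Integrals over the fibers of a discrete variable *)

Section integral_fibers.
Context (R : realType).
Local Open Scope ereal_scope.

Lemma ge0_integral_fibers d (T : measurableType d)
    (m : {measure set T -> \bar R}) (X : T -> nat) (A : set T)
    (phi : nat -> \bar R) :
  measurable A -> (forall B : set nat, measurable (X @^-1` B)) ->
  (forall k, 0 <= phi k) ->
  \int[m]_(x in A) phi (X x) =
  \sum_(0 <= k <oo) phi k * m (A `&` X @^-1` [set k]).
Proof.
move=> mA mX phi0.
have AE : A = \bigcup_k (A `&` X @^-1` [set k]).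
  by apply/seteqP; split=> [x Ax|x [k _ []]//]; exists (X x).
rewrite {1}AE ge0_integral_bigcup//; last 3 first.
- by move=> k; exact: measurableI.
- apply: (measurable_funS measurableT (@subsetT _ _)).
  by move=> _ B _; rewrite setTI; exact: (mX (phi @^-1` B)).
- exact: trivIset_preimage1_in.
apply: eq_eseriesr => k _.
rewrite (eq_integral (cst (phi k))); first by rewrite integral_cst//; exact: measurableI.
by move=> x; rewrite inE => -[_ /= ->].
Qed.

(** The factors [a1] and [a2] are cleared denominators: equality of two conditional laws is
    expressed without dividing by a mass that may be 0. *)
Lemma ge0_integral_fibers_eq d1 (T1 : measurableType d1)
    (m1 : {measure set T1 -> \bar R}) (X1 : T1 -> nat) (A1 : set T1)
    d2 (T2 : measurableType d2)
    (m2 : {measure set T2 -> \bar R}) (X2 : T2 -> nat) (A2 : set T2)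
    (a1 a2 : R) (phi : nat -> \bar R) :
  measurable A1 -> (forall B : set nat, measurable (X1 @^-1` B)) ->
  measurable A2 -> (forall B : set nat, measurable (X2 @^-1` B)) ->
  (forall k, a1%:E * m1 (A1 `&` X1 @^-1` [set k]) =
             a2%:E * m2 (A2 `&` X2 @^-1` [set k])) ->
  (forall k, 0 <= phi k) ->
  a1%:E * \int[m1]_(x in A1) phi (X1 x) = a2%:E * \int[m2]_(x in A2) phi (X2 x).
Proof.
move=> mA1 mX1 mA2 mX2 m12 phi0; rewrite !ge0_integral_fibers//.
rewrite -!nneseriesZl; try by move=> k _; rewrite mule_ge0.
by apply: eq_eseriesr => k _; rewrite muleCA m12 muleCA.
Qed.

Lemma integral_fibers_eq d1 (T1 : measurableType d1)
    (m1 : {measure set T1 -> \bar R}) (X1 : T1 -> nat) (A1 : set T1)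
    d2 (T2 : measurableType d2)
    (m2 : {measure set T2 -> \bar R}) (X2 : T2 -> nat) (A2 : set T2)
    (a1 a2 : R) (phi : nat -> \bar R) :
  measurable A1 -> (forall B : set nat, measurable (X1 @^-1` B)) ->
  measurable A2 -> (forall B : set nat, measurable (X2 @^-1` B)) ->
  (forall k, a1%:E * m1 (A1 `&` X1 @^-1` [set k]) =
             a2%:E * m2 (A2 `&` X2 @^-1` [set k])) ->
  m1.-integrable A1 (phi \o X1) -> m2.-integrable A2 (phi \o X2) ->
  a1%:E * \int[m1]_(x in A1) phi (X1 x) = a2%:E * \int[m2]_(x in A2) phi (X2 x).
Proof.
move=> mA1 mX1 mA2 mX2 m12 i1 i2; rewrite integralE [in RHS]integralE.
(* Integrability makes the positive parts finite, so the differences are well defined and the factor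
   distributes over them. *)
have def1 := fin_num_adde_defr (- \int[m1]_(x in A1) (phi \o X1)^\- x)
  (integrable_pos_fin_num mA1 i1).
have def2 := fin_num_adde_defr (- \int[m2]_(x in A2) (phi \o X2)^\- x)
  (integrable_pos_fin_num mA2 i2).
rewrite (muleBr _ def1)// (muleBr _ def2)//.
congr (_ - _).
- rewrite (funepos_comp phi X1) (funepos_comp phi X2).
  exact: (ge0_integral_fibers_eq mA1 mX1 mA2 mX2 m12 (funepos_ge0 phi)).
- rewrite (funeneg_comp phi X1) (funeneg_comp phi X2).
  exact: (ge0_integral_fibers_eq mA1 mX1 mA2 mX2 m12 (funeneg_ge0 phi)).
Qed.
End integral_fibers.

Lemma measure_fibers (R : realType) d (T : measurableType d)
    (m : {measure set T -> \bar R}) (X : T -> nat) (A : set T) :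
  (forall k, measurable (A `&` X @^-1` [set k])) ->
  m A = (\sum_(0 <= k <oo) m (A `&` X @^-1` [set k]))%E.
Proof.
move=> mAX; rewrite -[RHS](@eq_eseriesl _ [pred k | k \in setT]) => [|k]; last first.
  by rewrite /= in_setT.
rewrite -measure_bigcup//; last exact: trivIset_preimage1_in.
congr (m _); apply/seteqP; split=> [x Ax|x [k _ []]//].
by exists (X x).
Qed.

Lemma subset_nat_homo (T : Type) (F : nat -> set T) :
  (forall n, F n `<=` F n.+1) -> forall n m, (n <= m)%N -> F n `<=` F m.
Proof.
move=> FS n m; elim: m => [|m IHm]; first by rewrite leqn0 => /eqP ->.
rewrite leq_eqVlt => /predU1P[->//|]; rewrite ltnS => /IHm nm.
exact: subset_trans nm (FS m).
Qed.

(** * The sampling chain: adaptedness, law and conditional law *)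

Section coupling.
Context (R : realType) d (T : measurableType d) (P : probability T R).
Context dU (U : measurableType dU) (nu : probability U R).
Hypothesis nu_samples : samples_nat nu.
Variables (F : nat -> set (set T)) (X : nat -> T -> nat).
Hypothesis sub_measurable : forall n, F n `<=` measurable.
Hypothesis sub_succ : forall n, F n `<=` F n.+1.
Hypothesis F0 : forall D, F 0%N D -> D = set0 \/ D = setT.
Hypothesis X_preimage : forall n B, F n (X n @^-1` B).
Hypothesis X_saturated : forall n D x y, F n D -> X n x = X n y -> D x -> D y.

Local Notation S := (product_space (fun _ : nat => U)).

(** [t n k] turns one draw into a point of the atom numbered [k] at level [n], whose position
    relative to [F n.+1] follows [P] conditioned on that atom. Numbers not attained by [X n] have no
    atom to stay in. *)
Variable t : nat -> nat -> U -> T.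
Hypothesis t_fiber : forall n k, X n @^-1` [set k] !=set0 ->
  forall u, X n (t n k u) = k.
Hypothesis t_meas : forall n k D, F n.+1 D -> measurable (t n k @^-1` D).
Hypothesis t_law : forall n k D, F n.+1 D ->
  (P (X n @^-1` [set k]) * nu (t n k @^-1` D) = P (X n @^-1` [set k] `&` D))%E.

(** The move to stage [m.+1] reads coordinate [m.+1], so stage [n] depends on coordinates up to [n],
    in step with [canonical_filtration]. *)
Fixpoint chain (n : nat) (s : S) : T :=
  if n is m.+1 then t m (X m (chain m s)) (s m.+1) else point.

Lemma chain_fiber n s : X n (chain n.+1 s) = X n (chain n s).
Proof. by rewrite /= t_fiber//; exists (chain n s). Qed.

(** Each move from stage [m] stays in an atom of [F m], and for [n <= m] such an atom lies inside or
    outside [D] as a whole. *)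
Lemma chain_preimage n m D : (n <= m)%N -> F n D ->
  chain m @^-1` D = chain n @^-1` D.
Proof.
move=> + FD; elim: m => [|m IHm]; first by rewrite leqn0 => /eqP ->.
rewrite leq_eqVlt => /predU1P[->//|]; rewrite ltnS => nm.
rewrite -IHm//; have FmD := subset_nat_homo sub_succ nm FD.
by apply/seteqP; split=> s /=; apply: (X_saturated FmD); rewrite chain_fiber.
Qed.

(** Once the current atom is fixed, the next stage is a function of the fresh coordinate alone; this
    separates past from future. *)
Lemma chain_fiberE n k D :
  chain n @^-1` (X n @^-1` [set k]) `&` chain n.+1 @^-1` D =
  chain n @^-1` (X n @^-1` [set k]) `&` (fun s : S => s n.+1) @^-1` (t n k @^-1` D).
Proof. by apply/seteqP; split=> s [/= Xk]; rewrite Xk. Qed.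

Lemma chain_adapted n D : F n D ->
  canonical_filtration (fun _ : nat => U) n (chain n @^-1` D).
Proof.
elim: n D => [|n IHn] D FD.
  have [-> | ->] := F0 FD; first by rewrite preimage_set0; exact: canonical_filtration0.
  by rewrite preimage_setT; exact: canonical_filtrationT.
(* Split according to the atom at stage [n]: each piece is a past event intersected with a condition
   on coordinate [n.+1]. *)
rewrite (_ : chain n.+1 @^-1` D = \bigcup_k
    (chain n @^-1` (X n @^-1` [set k]) `&` chain n.+1 @^-1` D)).
  apply: canonical_filtration_bigcup => k; rewrite chain_fiberE.
  apply: canonical_filtrationI.
    exact/canonical_filtrationS/IHn/X_preimage.
  by apply: canonical_filtration_coordinate => //; exact: t_meas.
by apply/seteqP; split=> [s Ds|s [k _ []]//]; exists (X n (chain n s)).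
Qed.

Lemma chain_measurable n D : F n D -> measurable (chain n @^-1` D).
Proof. by move/chain_adapted; exact: canonical_filtration_measurable. Qed.

Variables (N : nat) (mu : nat -> probability U R) (Q : probability S R).
Hypothesis Qmu : is_product_measure mu Q.
Hypothesis mu_nu : forall k, (k <= N)%N -> mu k = nu.

Lemma chain_independent n k C D : (n < N)%N ->
  canonical_filtration (fun _ : nat => U) n C -> F n.+1 D ->
  (Q ((C `&` chain n @^-1` (X n @^-1` [set k])) `&` chain n.+1 @^-1` D) =
   Q (C `&` chain n @^-1` (X n @^-1` [set k])) * nu (t n k @^-1` D))%E.
Proof.
move=> nN CC FD; rewrite -setIA chain_fiberE setIA.
rewrite (canonical_filtration_independent Qmu _ (ltnSn n)) ?mu_nu//.
  by apply: canonical_filtrationI => //; exact/chain_adapted/X_preimage.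
exact: t_meas.
Qed.

Lemma chain_law n D : (n <= N)%N -> F n D -> Q (chain n @^-1` D) = P D.
Proof.
elim: n D => [|n IHn] D nN FD.
  have [-> | ->] := F0 FD; first by rewrite preimage_set0 !measure0.
  by rewrite preimage_setT !probability_setT.
(* Total probability over the atoms of [F n], on both spaces; the terms are then compared one by
   one. *)
rewrite (measure_fibers Q (X := X n \o chain n)); last first.
  move=> k; apply: measurableI; first exact: chain_measurable.
  by rewrite comp_preimage; exact: chain_measurable.
rewrite (measure_fibers P (X := X n)); last first.
  move=> k; apply: measurableI; first exact: sub_measurable FD.
  exact: (sub_measurable (X_preimage n _)).
apply: eq_eseriesr => k _; rewrite comp_preimage setIC.
have := chain_independent k nN (canonical_filtrationT _ n) FD.
rewrite setTI => indep; apply: (etrans indep).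
by rewrite (IHn _ (ltnW nN) (X_preimage n _)) (t_law k FD) setIC.
Qed.

(** A cross-multiplied Markov property: given the atom at stage [n], the past event [C] does not
    affect the law of the next stage. *)
Lemma chain_conditional_law n k C D : (n < N)%N ->
  canonical_filtration (fun _ : nat => U) n C -> F n.+1 D ->
  (P (X n @^-1` [set k]) *
     Q ((C `&` chain n @^-1` (X n @^-1` [set k])) `&` chain n.+1 @^-1` D) =
   Q (C `&` chain n @^-1` (X n @^-1` [set k])) * P (X n @^-1` [set k] `&` D))%E.
Proof.
by move=> nN CC FD; rewrite (chain_independent k nN CC FD) muleCA (t_law k FD).
Qed.

(** * Adapted variables read along the chain *)

Local Notation adapted n f := (g_sigma_algebra_preimage f `<=` F n).

Lemma adapted_level n (f : T -> R) a : adapted n f -> F n (f @^-1` [set a]).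
Proof. by apply; exists [set a]; [exact: measurable_set1|rewrite setTI]. Qed.

(** Level sets of [f] are unions of atoms, so [f] is constant on each atom. Integrals of [f] thereby
    reduce to fiber sums. *)
Lemma adapted_factor n (f : T -> R) :
  adapted n f -> exists phi : nat -> R, f = phi \o X n.
Proof.
move=> fF; exists (fun k => f (xget point [set x | X n x = k])).
apply/funext => x /=; apply/esym.
apply: (X_saturated (adapted_level (f x) fF) (x := x)) => //.
by apply/esym; apply: (@xgetPex _ point [set y | X n y = X n x]); exists x.
Qed.

Lemma chain_comp n m (f : T -> R) : (n <= m)%N -> adapted n f ->
  f \o chain m = f \o chain n.
Proof.
move=> nm fF; apply/funext => s /=.
have := chain_preimage nm (adapted_level (f (chain n s)) fF).
by move/seteqP => [_ /(_ s erefl)].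
Qed.

Lemma chain_comp_adapted n m (f : T -> R) : (n <= m)%N -> adapted n f ->
  g_sigma_algebra_preimage (f \o chain m) `<=`
  canonical_filtration (fun _ : nat => U) n.
Proof.
move=> nm fF _ [B mB <-]; rewrite setTI comp_preimage.
have FB : F n (f @^-1` B) by apply: fF; exists B => //; rewrite setTI.
by rewrite (chain_preimage nm FB); exact: chain_adapted.
Qed.

Let mX n B : measurable (X n @^-1` B).
Proof. exact: (sub_measurable (X_preimage n B)). Qed.

Let mXchain n B : measurable ((X n \o chain n) @^-1` B).
Proof. by rewrite comp_preimage; exact: chain_measurable. Qed.

Lemma chain_integrable n (f : T -> R) : (n <= N)%N -> adapted n f ->
  P.-integrable setT (EFin \o f) -> Q.-integrable setT (EFin \o (f \o chain n)).
Proof.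
move=> nN /adapted_factor[phi ->] /integrableP[_ fi]; apply/integrableP; split.
  by move=> _ B _; rewrite setTI; exact: (mXchain n ((EFin \o phi) @^-1` B)).
rewrite (_ : integral _ _ _ = (\int[P]_x `|(EFin \o (phi \o X n)) x|)%E)//.
have law k : (1%:E * Q ([set: S] `&` (X n \o chain n) @^-1` [set k]) =
              1%:E * P ([set: T] `&` X n @^-1` [set k]))%E.
  by rewrite !mul1e !setTI comp_preimage chain_law.
have := ge0_integral_fibers_eq measurableT (mXchain n) measurableT (@mX n) law
  (fun k => abse_ge0 (phi k)%:E).
by rewrite !mul1e.
Qed.

(** Since [f] factors through [X n.+1], [chain_conditional_law] on each fiber of [X n.+1] yields
    equal averages. *)
Lemma chain_integral_fiber n (f : T -> R) C k : (n < N)%N -> adapted n.+1 f ->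
  P.-integrable setT (EFin \o f) ->
  canonical_filtration (fun _ : nat => U) n C ->
  (P (X n @^-1` [set k]) *
     \int[Q]_(s in C `&` chain n @^-1` (X n @^-1` [set k])) (f (chain n.+1 s))%:E =
   Q (C `&` chain n @^-1` (X n @^-1` [set k])) *
     \int[P]_(x in X n @^-1` [set k]) (f x)%:E)%E.
Proof.
move=> nN fF fi CC; have mC := canonical_filtration_measurable CC.
have gi := chain_integrable nN fF fi.
have [phi fE] := adapted_factor fF; rewrite fE in fi gi *.
have mCk : measurable (C `&` chain n @^-1` (X n @^-1` [set k])).
  by apply: measurableI => //; exact: mXchain.
have law j : ((fine (P (X n @^-1` [set k])))%:E *
    Q ((C `&` chain n @^-1` (X n @^-1` [set k])) `&`
       (X n.+1 \o chain n.+1) @^-1` [set j]) =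
    (fine (Q (C `&` chain n @^-1` (X n @^-1` [set k]))))%:E *
    P (X n @^-1` [set k] `&` X n.+1 @^-1` [set j]))%E.
  rewrite !fineK ?fin_num_measure//; exact: chain_conditional_law.
have := integral_fibers_eq (phi := EFin \o phi) mCk (mXchain n.+1) (mX n [set k])
  (@mX n.+1) law (integrableS measurableT mCk (@subsetT _ _) gi)
  (integrableS measurableT (mX n [set k]) (@subsetT _ _) fi).
by rewrite !fineK ?fin_num_measure.
Qed.

(** [C] is cut along the atoms of [F n]. On each piece the integrals of [f] and [f'] are the same
    multiple of their integrals over the atom under [P], which agree by hypothesis. *)
Lemma chain_martingale_step n (f f' : T -> R) C : (n < N)%N ->
  adapted n.+1 f -> P.-integrable setT (EFin \o f) ->
  adapted n f' -> P.-integrable setT (EFin \o f') ->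
  (forall A, F n A ->
    \int[P]_(x in A) (f' x)%:E = \int[P]_(x in A) (f x)%:E)%E ->
  canonical_filtration (fun _ : nat => U) n C ->
  (\int[Q]_(s in C) (f' (chain n.+1 s))%:E =
   \int[Q]_(s in C) (f (chain n.+1 s))%:E)%E.
Proof.
move=> nN fF fi f'F f'i ff' CC; have mC := canonical_filtration_measurable CC.
have f'F1 : adapted n.+1 f' by move=> D /f'F; exact: sub_succ.
pose Ck k := C `&` chain n @^-1` (X n @^-1` [set k]).
have mCk k : measurable (Ck k) by apply: measurableI => //; exact: mXchain.
have CE : C = \bigcup_k Ck k.
  by apply/seteqP; split=> [s Cs|s [k _ []]//]; exists (X n (chain n s)).
have tCk : trivIset setT Ck by exact: (@trivIset_preimage1_in _ _ _ _ (X n \o chain n)).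
have int_sum h : adapted n.+1 h -> P.-integrable setT (EFin \o h) ->
    (\int[Q]_(s in C) (h (chain n.+1 s))%:E =
     \sum_(0 <= k <oo) \int[Q]_(s in Ck k) (h (chain n.+1 s))%:E)%E.
  move=> hF hi; rewrite {1}CE integral_bigcup// -CE.
  exact: integrableS measurableT mC (@subsetT _ _) (chain_integrable nN hF hi).
rewrite !int_sum//; apply: eq_eseriesr => k _.
have Ef := chain_integral_fiber k nN fF fi CC.
have Ef' := chain_integral_fiber k nN f'F1 f'i CC.
(* Over a null atom the cross-multiplied identities say nothing, but there the piece [Ck k] is
   itself [Q]-null. *)
have [PA0|PA0] := eqVneq (P (X n @^-1` [set k])) 0%E.
  have QC0 : Q (Ck k) = 0%E.
    apply/eqP; rewrite -measure_le0 -PA0 -(chain_law (ltnW nN) (X_preimage n _)).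
    by apply: le_measure; rewrite ?inE//; [exact: mXchain|exact: subIsetr].
  rewrite !null_set_integral//.
    exact: measurable_int (integrableS measurableT (mCk k) (@subsetT _ _)
      (chain_integrable nN fF fi)).
  exact: measurable_int (integrableS measurableT (mCk k) (@subsetT _ _)
    (chain_integrable nN f'F1 f'i)).
have [p PE] : exists p, P (X n @^-1` [set k]) = p%:E.
  by exists (fine (P (X n @^-1` [set k]))); rewrite fineK// fin_num_measure.
rewrite PE in PA0 Ef Ef'.
have : (p^-1%:E * (p%:E * \int[Q]_(s in Ck k) (f' (chain n.+1 s))%:E) =
        p^-1%:E * (p%:E * \int[Q]_(s in Ck k) (f (chain n.+1 s))%:E))%E.
  by rewrite Ef Ef' ff'//; exact: X_preimage.
by rewrite !muleA -!EFinM mulVf ?mul1e// -eqe.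
Qed.

End coupling.

(** * Assembly of the samplers, the product measure and the martingale *)

Theorem theorem1 (R : realType) (d : measure_display) (Omega : measurableType d)
    (P : probability Omega R) (N : nat) (F : nat -> set (set Omega)) :
  discrete_space Omega -> (1 <= N)%N -> filtration N F ->
  exists (dS : nat -> measure_display) (S : forall i, measurableType (dS i))
    (mu : forall i, probability (S i) R) (Q : probability (product_space S) R),
    is_product_measure mu Q /\
    forall f : nat -> Omega -> R, martingale P N F f ->
    exists g : nat -> product_space S -> R,
      martingale Q N (canonical_filtration S) g /\
      same_joint_distribution P Q N f g.
Proof.
move=> cT N1 [sF FS].
(* The trivial sigma-algebra put in front lets the chain start at any point. *)
pose G n : set (set Omega) :=
  if n is 0%N then [set D | D = set0 \/ D = setT] else F (minn n N).
have GE n : (1 <= n <= N)%N -> G n = F n.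
  by case: n => // n /andP[_ nN]; rewrite /G (minn_idPl nN).
have G0 D : G 0%N D -> D = set0 \/ D = setT by [].
have minN n : (1 <= minn n.+1 N <= N)%N by rewrite leq_min N1 geq_minr.
have GsF n : sigma_algebra setT (G n).
  case: n => [|n]; last by have [] := sF _ (minN n).
  split=> [|A [->|->]|A GA]; first by left.
  - by right; rewrite setD0.
  - by left; rewrite setDv.
  - have [[k Ak]|A0] := pselect (exists k, A k = setT); [right|left].
      by apply/seteqP; split=> // x _; exists k => //; rewrite Ak.
    by rewrite bigcup0// => k _; have [//|AT] := GA k; case: A0; exists k.
have Gm n : G n `<=` measurable.
  by case: n => [D [->|->]//|n]; have [] := sF _ (minN n).
have GS n : G n `<=` G n.+1.
  case: n => [D [->|->]|n].
  - by have [] := GsF 1%N.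
  - by have [H0 GC _] := GsF 1%N; rewrite -(setD0 setT); exact: GC.
  (* From level [N] on, [minn] keeps [G] constant, so it increases at every index. *)
  - rewrite /G /=; have [nN|Nn] := ltnP n.+1 N.
      by rewrite (minn_idPl nN); exact: FS.
    by rewrite (minn_idPr (leqW Nn)).
have /choice[X XP] := fun n => countable_sigma_algebra_atoms cT (GsF n).
have GX n B : G n (X n @^-1` B) by have [] := XP n.
have Xsat n D x y : G n D -> X n x = X n y -> D x -> D y.
  by have [_ /(_ D x y)] := XP n.
pose nu := uniform_prob (@ltr01 R) : probability _ R.
have /choice[t tP] : forall nk : nat * nat, exists t,
    ((X nk.1 @^-1` [set nk.2]) !=set0 -> forall u, X nk.1 (t u) = nk.2) /\
    forall D, (forall x y, X nk.1.+1 x = X nk.1.+1 y -> D x -> D y) ->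
      measurable (t @^-1` D) /\
      (P (X nk.1 @^-1` [set nk.2]) * nu (t @^-1` D) =
       P (X nk.1 @^-1` [set nk.2] `&` D))%E.
  move=> [n k]; apply: conditional_sampling; first exact: uniform_samples_nat.
    by move=> B; exact: Gm (GX n.+1 B).
  exact: Gm (GX n _).
pose t' n k := t (n, k).
have t_fiber n k : X n @^-1` [set k] !=set0 -> forall u, X n (t' n k u) = k.
  by have [+ _] := tP (n, k); apply.
have t_meas n k D : G n.+1 D -> measurable (t' n k @^-1` D).
  by move=> GD; have [_ /(_ D (fun x y => @Xsat _ D x y GD))[]] := tP (n, k).
have t_law n k D : G n.+1 D ->
    (P (X n @^-1` [set k]) * nu (t' n k @^-1` D) = P (X n @^-1` [set k] `&` D))%E.
  by move=> GD; have [_ /(_ D (fun x y => @Xsat _ D x y GD))[]] := tP (n, k).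
(* Only the coordinates up to [N] are used: the others are made deterministic, so
   that no infinite product of nontrivial measures has to be constructed. *)
pose mu i : probability _ R := if (i < N.+1)%N then nu else dirac point.
have [Q Qmu] : exists Q : probability (product_space (fun _ : nat => _)) R,
    is_product_measure mu Q.
  exact: product_measure_splice (dirac_product_measure R (fun _ : nat => point)).
have mu_nu k : (k <= N)%N -> mu k = nu by rewrite /mu ltnS => ->.
exists (fun=> _), (fun=> _), mu, Q; split=> // f [fi fE].
pose Y := chain X t'.
have fG n : (1 <= n <= N)%N -> g_sigma_algebra_preimage (f n) `<=` G n.
  move=> nN; rewrite GE//; have [|//] := fE n n (proj1 (andP nN)).
  by rewrite leqnn; case/andP: nN.
have fY n m : (1 <= n)%N -> (n <= m <= N)%N -> f n \o Y m = f n \o Y n.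
  move=> n1 /andP[nm mN]; apply: (chain_comp GS Xsat t_fiber nm); apply: fG.
  by rewrite n1 (leq_trans nm).
have gi n : (1 <= n <= N)%N -> Q.-integrable setT (EFin \o (f n \o Y N)).
  move=> nN; have /andP[n1 nleN] := nN; rewrite fY ?nleN ?leqnn//.
  exact: (chain_integrable Gm G0 GX Xsat t_meas t_law Qmu mu_nu nleN
    (fG _ nN) (fi _ nN)).
(* All variables are read at the same end point [Y N], so their joint law follows from the law of
   [Y N] on [G N]; [fY] goes back to [Y n] for adaptedness. *)
exists (fun n => f n \o Y N); split.
  split=> [//|n m n1 /andP[nm mN]]; have nN := leq_trans nm mN.
  have n1N : (1 <= n <= N)%N by rewrite n1.
  split; [|exact: gi|move=> C CC].
    exact: (chain_comp_adapted GS G0 GX Xsat t_fiber t_meas nN (fG _ n1N)).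
  (* One-step identities are chained from [n] up to [m]; [C] remains an admissible past event at
     each later level. *)
  elim: m nm mN => [|m IHm] nm mN; first by case: n n1 nm {CC nN n1N}.
  move: nm; rewrite leq_eqVlt => /predU1P[->//|]; rewrite ltnS => nm.
  rewrite (IHm nm (ltnW mN)).
  have m1 := leq_trans n1 nm.
  have m1N : (1 <= m <= N)%N by rewrite m1 ltnW.
  have mS1N : (1 <= m.+1 <= N)%N by [].
  have gE : f m \o Y N = f m \o Y m.+1.
    by rewrite (fY m N) ?(fY m m.+1)// ?leqnSn// ltnW//= leqnn.
  have gSE : f m.+1 \o Y N = f m.+1 \o Y m.+1 by rewrite (fY m.+1 N)// mN leqnn.
  have CCm := subset_nat_homo (@canonical_filtrationS _ _) nm CC.
  have := chain_martingale_step Gm GS G0 GX Xsat t_meas t_law Qmu mu_nu mN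
    (fG _ mS1N) (fi _ mS1N) (fG _ m1N) (fi _ m1N) _ CCm.
  rewrite -/Y => step.
  rewrite (_ : (fun s => _) = EFin \o (f m \o Y m.+1)); last by rewrite -gE.
  rewrite [in RHS](_ : (fun s => _) = EFin \o (f m.+1 \o Y m.+1)); last by rewrite -gSE.
  apply: step => A; rewrite GE// => FA.
  by have [|_ _] := fE m m.+1 m1; [rewrite leqnSn|exact].
move=> B _; rewrite /joint_distribution /pushforward.
pose D := (fun x => [tuple f i.+1 x | i < N]) @^-1` B.
have GD : G N D.
  (* Every [f i.+1] factors through [X N], so [D] is a union of atoms of [G N]. *)
  rewrite (_ : D = X N @^-1` (X N @` D)); first exact: GX.
  apply/seteqP; split=> [x Dx|x [y Dy yx]]; first by exists x.
  rewrite /D /= (_ : [tuple f i.+1 x | i < N] = [tuple f i.+1 y | i < N])//.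
  apply: eq_from_tnth => i; rewrite !tnth_mktuple.
  have iN : (1 <= i.+1 <= N)%N by rewrite ltn_ord.
  have [phi ->] := adapted_factor Xsat
    (subset_trans (fG _ iN) (subset_nat_homo GS (ltn_ord i))).
  by rewrite /= yx.
exact/esym/(chain_law Gm G0 GX t_meas t_law Qmu mu_nu (leqnn N) GD).
Qed.
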